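(* Let $A$ be an associative algebra and $(M_1\xrightarrow{\delta}M_0,\nu)$ be a $2$-term bimodule up to homotopy of $A$. Then the triple $$\mathfrak{a}:=(M_1\xrightarrow{\widetilde{\delta}}A\oplus M_0,\odot,\mu)$$ is a $2$-term $A_\infty$-algebra, where $\widetilde{\delta}(\xi)=(0,\delta(\xi))$, and $$(a,u)\odot(b,v):=(ab,\,av+ub),\quad(a,u)\odot\xi:=a\xi,\quad\xi\odot(a,u):=\xi a,\quad\xi\odot\eta:=0,$$ $$\mu((a,u),(b,v),(c,w)):=\nu(a,b,w)+\nu(a,v,c)+\nu(u,b,c),$$ for all $(a,u),(b,v),(c,w)\in A\oplus M_0$ and $\xi,\eta\in M_1$.
   Context: All vector spaces are over a field $\mathbf{k}$ of characteristic $0$; associative algebras are not assumed unital. **2-term $A_\infty$-algebras.** A $2$-term $A_\infty$-algebra $(A_1\xrightarrow{\delta}A_0,\odot,\mu)$ consists of a linear map $\delta:A_1\to A_0$ of vector spaces, bilinear maps $\odot:A_i\times A_j\to A_{i+j}$ ($0\le i+j\le1$; the product of two elements of $A_1$ is understood to be zero) and a trilinear map $\mu:A_0\times A_0\times A_0\to A_1$ such that for all $x,y,z,t\in A_0$, $h,k\in A_1$: (A1) $\delta(x\odot h)=x\odot\delta(h)$; (A2) $\delta(h\odot x)=\delta(h)\odot x$; (A3) $\delta(h)\odot k=h\odot\delta(k)$; (A4) $x\odot(y\odot z)-(x\odot y)\odot z=\delta(\mu(x,y,z))$; (A5) $x\odot(y\odot h)-(x\odot y)\odot h=\mu(x,y,\delta(h))$;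 (A6) $x\odot(h\odot y)-(x\odot h)\odot y=\mu(x,\delta(h),y)$; (A7) $h\odot(x\odot y)-(h\odot x)\odot y=\mu(\delta(h),x,y)$; (A8) $x\odot\mu(y,z,t)-\mu(x\odot y,z,t)+\mu(x,y\odot z,t)-\mu(x,y,z\odot t)+\mu(x,y,z)\odot t=0$. **2-term bimodules up to homotopy.** Let $A$ be an associative algebra. A $2$-term bimodule up to homotopy of $A$, denoted $(M_1\xrightarrow{\delta}M_0,\nu)$, consists of a linear map $\delta:M_1\to M_0$ of vector spaces; four bilinear maps $A\times M_0\to M_0$, $(a,v)\mapsto av$; $M_0\times A\to M_0$, $(v,a)\mapsto va$; $A\times M_1\to M_1$, $(a,\xi)\mapsto a\xi$; $M_1\times A\to M_1$, $(\xi,a)\mapsto\xi a$, satisfying $\delta(a\xi)=a\delta(\xi)$ and $\delta(\xi a)=\delta(\xi)a$; and three trilinear maps, all denoted $\nu$, $$\nu:A\times A\times M_0\to M_1,\quad\nu:A\times M_0\times A\to M_1,\quad\nu:M_0\times A\times A\to M_1,$$ such that for all $a,b,c\in A$, $v\in M_0$, $\xi\in M_1$: $a(bv)-(ab)v=\delta(\nu(a,b,v))$, $\ a(vb)-(av)b=\delta(\nu(a,v,b))$, $\ v(ab)-(va)b=\delta(\nu(v,a,b))$; $a(b\xi)-(ab)\xi=\nu(a,b,\delta(\xi))$, $\ a(\xi b)-(a\xi)b=\nu(a,\delta(\xi),b)$, $\ \xi(ab)-(\xi a)b=\nu(\delta(\xi),a,b)$; $a\,\nu(b,c,v)-\nu(ab,c,v)+\nu(a,bc,v)-\nu(a,b,cv)=0$;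 $a\,\nu(b,v,c)-\nu(ab,v,c)+\nu(a,bv,c)-\nu(a,b,vc)+\nu(a,b,v)\,c=0$; $a\,\nu(v,b,c)-\nu(av,b,c)+\nu(a,vb,c)-\nu(a,v,bc)+\nu(a,v,b)\,c=0$; $\nu(va,b,c)-\nu(v,ab,c)+\nu(v,a,bc)-\nu(v,a,b)\,c=0$. *)

(* Defs.v *)
From mathcomp Require Import all_boot all_algebra.

Set Implicit Arguments.
Unset Strict Implicit.
Unset Printing Implicit Defensive.

Import GRing.Theory.
Local Open Scope ring_scope.

Definition bilinear_map (k : fieldType) (U V W : lmodType k)
    (f : U -> V -> W) : Prop :=
  bilinear_for *:%R *:%R f.

Definition trilinear_map (k : fieldType) (U V W X : lmodType k)
    (f : U -> V -> W -> X) : Prop :=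
  [/\ forall v w, linear (fun u => f u v w),
      forall u w, linear (fun v => f u v w)
    & forall u v, linear (fun w => f u v w)].

(* MathComp rings are unital, so a possibly non-unital associative algebra is a
   vector space with an explicit multiplication. *)
Record is_assoc_algebra (k : fieldType) (A : lmodType k)
    (mul : A -> A -> A) : Prop := {
  alg_mul_bilinear : bilinear_map mul;
  alg_mulA : associative mul
}.

(* The maps of a 2-term A_oo-algebra, before any axiom is imposed: [Aprod_ij] is
   the product A_i x A_j -> A_(i+j).  As A_2 = 0, the product of two elements of
   A_1 carries no data; it is kept as a map into A_1 that the axioms force to
   vanish. *)
Record Ainf2_data (k : fieldType) (A1 A0 : lmodType k) := Ainf2Data {
  Adelta : A1 -> A0;
  Aprod00 : A0 -> A0 -> A0;
  Aprod01 : A0 -> A1 -> A1;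
  Aprod10 : A1 -> A0 -> A1;
  Aprod11 : A1 -> A1 -> A1;
  Amu : A0 -> A0 -> A0 -> A1
}.

Record is_Ainf2 (k : fieldType) (A1 A0 : lmodType k)
    (D : Ainf2_data A1 A0) (delta := Adelta D)
    (p00 := Aprod00 D) (p01 := Aprod01 D) (p10 := Aprod10 D) (mu := Amu D) :
    Prop := {
  Adelta_linear : linear delta;
  Aprod00_bilinear : bilinear_map p00;
  Aprod01_bilinear : bilinear_map p01;
  Aprod10_bilinear : bilinear_map p10;
  Aprod11_zero : forall h l : A1, Aprod11 D h l = 0;
  Amu_trilinear : trilinear_map mu;
  Ainf_A1 : forall x h, delta (p01 x h) = p00 x (delta h);
  Ainf_A2 : forall h x, delta (p10 h x) = p00 (delta h) x;
  Ainf_A3 : forall h l, p01 (delta h) l = p10 h (delta l);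
  Ainf_A4 : forall x y z,
    p00 x (p00 y z) - p00 (p00 x y) z = delta (mu x y z);
  Ainf_A5 : forall x y h,
    p01 x (p01 y h) - p01 (p00 x y) h = mu x y (delta h);
  Ainf_A6 : forall x h y,
    p01 x (p10 h y) - p10 (p01 x h) y = mu x (delta h) y;
  Ainf_A7 : forall h x y,
    p10 h (p00 x y) - p10 (p10 h x) y = mu (delta h) x y;
  Ainf_A8 : forall x y z t,
    p01 x (mu y z t) - mu (p00 x y) z t + mu x (p00 y z) t
      - mu x y (p00 z t) + p10 (mu x y z) t = 0
}.

(* The maps of a 2-term bimodule up to homotopy: [l0], [r0] (resp. [l1], [r1])
   are the left and right actions of A on M_0 (resp. M_1), and the three [nu]
   are named after the position of M_0 among the arguments. *)
Record bimod2_data (k : fieldType) (A M1 M0 : lmodType k) := Bimod2Data {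
  Mdelta : M1 -> M0;
  Ml0 : A -> M0 -> M0;
  Mr0 : M0 -> A -> M0;
  Ml1 : A -> M1 -> M1;
  Mr1 : M1 -> A -> M1;
  nuAAM : A -> A -> M0 -> M1;
  nuAMA : A -> M0 -> A -> M1;
  nuMAA : M0 -> A -> A -> M1
}.

Record is_bimod2 (k : fieldType) (A M1 M0 : lmodType k) (mul : A -> A -> A)
    (M : bimod2_data A M1 M0) (delta := Mdelta M)
    (l0 := Ml0 M) (r0 := Mr0 M) (l1 := Ml1 M) (r1 := Mr1 M)
    (nu3 := nuAAM M) (nu2 := nuAMA M) (nu1 := nuMAA M) : Prop := {
  Mdelta_linear : linear delta;
  Ml0_bilinear : bilinear_map l0;
  Mr0_bilinear : bilinear_map r0;
  Ml1_bilinear : bilinear_map l1;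
  Mr1_bilinear : bilinear_map r1;
  nuAAM_trilinear : trilinear_map nu3;
  nuAMA_trilinear : trilinear_map nu2;
  nuMAA_trilinear : trilinear_map nu1;
  Mdelta_l : forall a xi, delta (l1 a xi) = l0 a (delta xi);
  Mdelta_r : forall xi a, delta (r1 xi a) = r0 (delta xi) a;
  Massoc0_AAM : forall a b v,
    l0 a (l0 b v) - l0 (mul a b) v = delta (nu3 a b v);
  Massoc0_AMA : forall a v b,
    l0 a (r0 v b) - r0 (l0 a v) b = delta (nu2 a v b);
  Massoc0_MAA : forall v a b,
    r0 v (mul a b) - r0 (r0 v a) b = delta (nu1 v a b);
  Massoc1_AAM : forall a b xi,
    l1 a (l1 b xi) - l1 (mul a b) xi = nu3 a b (delta xi);
  Massoc1_AMA : forall a xi b,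
    l1 a (r1 xi b) - r1 (l1 a xi) b = nu2 a (delta xi) b;
  Massoc1_MAA : forall xi a b,
    r1 xi (mul a b) - r1 (r1 xi a) b = nu1 (delta xi) a b;
  Mcoh_AAAM : forall a b c v,
    l1 a (nu3 b c v) - nu3 (mul a b) c v + nu3 a (mul b c) v
      - nu3 a b (l0 c v) = 0;
  Mcoh_AAMA : forall a b v c,
    l1 a (nu2 b v c) - nu2 (mul a b) v c + nu2 a (l0 b v) c
      - nu3 a b (r0 v c) + r1 (nu3 a b v) c = 0;
  Mcoh_AMAA : forall a v b c,
    l1 a (nu1 v b c) - nu1 (l0 a v) b c + nu2 a (r0 v b) c
      - nu2 a v (mul b c) + r1 (nu2 a v b) c = 0;
  Mcoh_MAAA : forall v a b c,
    nu1 (r0 v a) b c - nu1 v (mul a b) c + nu1 v a (mul b c)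
      - r1 (nu1 v a b) c = 0
}.

Definition semidirect_data (k : fieldType) (A M1 M0 : lmodType k)
    (mul : A -> A -> A) (M : bimod2_data A M1 M0) :
    Ainf2_data M1 (A * M0)%type := {|
  Adelta := fun xi => (0, Mdelta M xi);
  Aprod00 := fun x y => (mul x.1 y.1, Ml0 M x.1 y.2 + Mr0 M x.2 y.1);
  Aprod01 := fun x xi => Ml1 M x.1 xi;
  Aprod10 := fun xi x => Mr1 M xi x.1;
  Aprod11 := fun _ _ => 0;
  Amu := fun x y z =>
    nuAAM M x.1 y.1 z.2 + nuAMA M x.1 y.2 z.1 + nuMAA M x.2 y.1 z.1
|}.

(* Main.v *)
Require Import Defs.
From mathcomp Require Import all_boot all_algebra.

(** The algebra [a] is a square-zero extension of [A] by the homotopy bimodule: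
    every operation of [a] is a sum of structure maps of [A] and [M] in which
    exactly one argument is taken from [M] and all the others from [A], plus the
    product of [A] itself.  Hence each axiom of [a], expanded by multilinearity,
    splits into one identity for each position of the argument from [M].

    An axiom involving one element of [M_1] leaves only one position, because
    [(0, delta xi)] has no component in [A]; it is then one of the bimodule
    axioms.  In the axiom with two elements of [M_1] both sides vanish.  The associator axiom (lemma [semidirect_assoc]) is the
    associativity of [A] in the first component, and the sum of the three
    associator identities on [M_0] in the second.  The pentagon axiom (lemma
    [semidirect_pentagon]) is the sum of the four coherence identities of [nu],
    the one with [M_0] in the first position occurring with the opposite sign. *)

Set Implicit Arguments.
Unset Strict Implicit.
Unset Printing Implicit Defensive.

Import GRing.Theory.
Local Open Scope ring_scope.

(** * Linear and multilinear maps given by predicates *)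

Section LinearMaps.

Variables (k : fieldType) (U V W : lmodType k).

Lemma linearD_of (f : U -> V) : linear f -> {morph f : x y / x + y}.
Proof. by move=> lf x y; rewrite -[x]scale1r lf !scale1r. Qed.

Lemma linear0_of (f : U -> V) : linear f -> f 0 = 0.
Proof. by move=> /linearD_of fD; apply: (addrI (f 0)); rewrite -fD !addr0. Qed.

Lemma linear_add (f g : U -> V) :
  linear f -> linear g -> linear (fun x => f x + g x).
Proof. by move=> lf lg c x y; rewrite lf lg scalerDr addrACA. Qed.

Lemma linear_pair (f : U -> V) (g : U -> W) :
  linear f -> linear g -> linear (fun x => (f x, g x)).
Proof. by move=> lf lg c x y; rewrite lf lg. Qed.

Lemma linear_zero : linear (fun _ : U => 0 : V).
Proof. by move=> c x y; rewrite scaler0 addr0. Qed.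

Lemma linear_comp_of (f : V -> W) (g : U -> V) :
  linear f -> linear g -> linear (fun x => f (g x)).
Proof. by move=> lf lg c x y; rewrite lg lf. Qed.

Lemma linear_fst : linear (fun x : U * V => x.1).
Proof. by []. Qed.

Lemma linear_snd : linear (fun x : U * V => x.2).
Proof. by []. Qed.

End LinearMaps.

Section MultilinearMaps.

Variable k : fieldType.

Lemma bilinear_map_add (U V W : lmodType k) (f g : U -> V -> W) :
  bilinear_map f -> bilinear_map g -> bilinear_map (fun u v => f u v + g u v).
Proof.
move=> [f1 f2] [g1 g2]; split=> [v|u].
  exact: linear_add (f1 v) (g1 v).
exact: linear_add (f2 u) (g2 u).
Qed.

Lemma bilinear_map_pair (U V W X : lmodType k) (f : U -> V -> W)
    (g : U -> V -> X) :
  bilinear_map f -> bilinear_map g -> bilinear_map (fun u v => (f u v, g u v)).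
Proof.
move=> [f1 f2] [g1 g2]; split=> [v|u].
  exact: linear_pair (f1 v) (g1 v).
exact: linear_pair (f2 u) (g2 u).
Qed.

Lemma bilinear_map_comp (U V U' V' W : lmodType k) (f : U -> V -> W)
    (p : U' -> U) (q : V' -> V) :
  bilinear_map f -> linear p -> linear q ->
  bilinear_map (fun u v => f (p u) (q v)).
Proof.
move=> [f1 f2] lp lq; split=> [v|u].
  exact: linear_comp_of (f1 (q v)) lp.
exact: linear_comp_of (f2 (p u)) lq.
Qed.

Lemma trilinear_map_add (U V W X : lmodType k) (f g : U -> V -> W -> X) :
  trilinear_map f -> trilinear_map g ->
  trilinear_map (fun u v w => f u v w + g u v w).
Proof.
move=> [f1 f2 f3] [g1 g2 g3]; split=> x y.
- exact: linear_add (f1 x y) (g1 x y).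
- exact: linear_add (f2 x y) (g2 x y).
- exact: linear_add (f3 x y) (g3 x y).
Qed.

Lemma trilinear_map_comp (U V W U' V' W' X : lmodType k)
    (f : U -> V -> W -> X) (p : U' -> U) (q : V' -> V) (r : W' -> W) :
  trilinear_map f -> linear p -> linear q -> linear r ->
  trilinear_map (fun u v w => f (p u) (q v) (r w)).
Proof.
move=> [f1 f2 f3] lp lq lr; split=> x y.
- exact: linear_comp_of (f1 (q x) (r y)) lp.
- exact: linear_comp_of (f2 (p x) (r y)) lq.
- exact: linear_comp_of (f3 (p x) (q y)) lr.
Qed.

End MultilinearMaps.

(** Splits the pentagon of a [mu] that is a sum into one pentagon for each
    summand. *)
Lemma pentagonD (V : zmodType) (a b c d e a' b' c' d' e' : V) :
  (a + a') - (b + b') + (c + c') - (d + d') + (e + e') =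
  (a - b + c - d + e) + (a' - b' + c' - d' + e').
Proof.
by rewrite !opprD; do 4!(rewrite [RHS]addrACA; congr (_ + _)).
Qed.

(** * The square-zero extension *)

Section Semidirect.

Variables (k : fieldType) (A M1 M0 : lmodType k) (mul : A -> A -> A).
Variable M : bimod2_data A M1 M0.
Hypotheses (A_alg : is_assoc_algebra mul) (M_bimod : is_bimod2 mul M).

Let D := semidirect_data mul M.

Lemma semidirect_prod_bilinear : bilinear_map (Aprod00 D).
Proof.
apply: bilinear_map_pair.
  exact: bilinear_map_comp (alg_mul_bilinear A_alg) (@linear_fst _ _ _)
    (@linear_fst _ _ _).
apply: bilinear_map_add.
  exact: bilinear_map_comp (Ml0_bilinear M_bimod) (@linear_fst _ _ _)
    (@linear_snd _ _ _).
exact: bilinear_map_comp (Mr0_bilinear M_bimod) (@linear_snd _ _ _)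
  (@linear_fst _ _ _).
Qed.

Lemma semidirect_mu_trilinear : trilinear_map (Amu D).
Proof.
apply: trilinear_map_add; first apply: trilinear_map_add.
- exact: trilinear_map_comp (nuAAM_trilinear M_bimod) (@linear_fst _ _ _)
    (@linear_fst _ _ _) (@linear_snd _ _ _).
- exact: trilinear_map_comp (nuAMA_trilinear M_bimod) (@linear_fst _ _ _)
    (@linear_snd _ _ _) (@linear_fst _ _ _).
- exact: trilinear_map_comp (nuMAA_trilinear M_bimod) (@linear_snd _ _ _)
    (@linear_fst _ _ _) (@linear_fst _ _ _).
Qed.

(** The associator of [A] vanishes, and the component in [M_0] is the sum of the
    three associators with one argument in [M_0], each of which is the
    boundary of a value of [nu]. *)
Lemma semidirect_assoc x y z :
  Aprod00 D x (Aprod00 D y z) - Aprod00 D (Aprod00 D x y) z =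
  Adelta D (Amu D x y z).
Proof.
have [l2 r1] := ((Ml0_bilinear M_bimod).2, (Mr0_bilinear M_bimod).1).
have dD := linearD_of (Mdelta_linear M_bimod).
case: x y z => [a u] [b v] [c w] /=; congr pair => /=.
  by rewrite (alg_mulA A_alg) subrr.
rewrite !dD -(Massoc0_AAM M_bimod) -(Massoc0_AMA M_bimod).
rewrite -(Massoc0_MAA M_bimod) (linearD_of (l2 a)) (linearD_of (r1 c)) /=.
by rewrite [in X in _ - X]addrA !opprD; do 2!(rewrite addrACA; congr (_ + _)).
Qed.

(** After expansion, the terms fall into the four coherence identities of [nu]
    according to the position of the argument from [M_0].  The identities for
    the two outer positions have one term fewer, since [M_0] acts on [M_1] by
    zero. *)
Lemma semidirect_pentagon x y z t :
  Aprod01 D x (Amu D y z t) - Amu D (Aprod00 D x y) z t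
    + Amu D x (Aprod00 D y z) t - Amu D x y (Aprod00 D z t)
    + Aprod10 D (Amu D x y z) t = 0.
Proof.
have [_ _ nu3D] := nuAAM_trilinear M_bimod.
have [_ nu2D _] := nuAMA_trilinear M_bimod.
have [nu1D _ _] := nuMAA_trilinear M_bimod.
have [l2 r1] := ((Ml1_bilinear M_bimod).2, (Mr1_bilinear M_bimod).1).
case: x y z t => [a u] [b v] [c w] [d s] /=.
rewrite !(linearD_of (l2 a)) !(linearD_of (r1 d)) (linearD_of (nu3D _ _)).
rewrite (linearD_of (nu2D _ _)) (linearD_of (nu1D _ _)) /=.
(* The two missing terms are restored as zeros, so that each of the five
   summands becomes a sum over the four positions, in the same order. *)
rewrite -[_ + Ml1 M a (nuMAA M v c d)]addr0 -[Mr1 M (nuAAM M a b w) d]add0r.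
rewrite [_ + (nuMAA M _ c d + _)]addrA [nuAAM M a (mul b c) s + _]addrA.
rewrite !pentagonD.
rewrite addr0 (Mcoh_AAAM M_bimod) (Mcoh_AAMA M_bimod) (Mcoh_AMAA M_bimod).
rewrite !add0r -[RHS]oppr0 -(Mcoh_MAAA M_bimod u b c d).
by rewrite !(opprD, opprK).
Qed.

End Semidirect.

Theorem theorem5p6 (k : fieldType) (char0 : [pchar k]%R =i pred0)
    (A M1 M0 : lmodType k) (mul : A -> A -> A)
    (A_alg : is_assoc_algebra mul)
    (M : bimod2_data A M1 M0) (M_bimod : is_bimod2 mul M) :
  is_Ainf2 (semidirect_data mul M).
Proof.
have [m1 m2] := alg_mul_bilinear A_alg.
have [l1 l2] := Ml0_bilinear M_bimod; have [r1 r2] := Mr0_bilinear M_bimod.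
have [n21 _ n23] := nuAMA_trilinear M_bimod.
have [_ n12 n13] := nuMAA_trilinear M_bimod.
have [n31 n32 _] := nuAAM_trilinear M_bimod.
have idL (U : lmodType k) : linear (@id U) by [].
split.
- exact: linear_pair (@linear_zero _ _ _) (Mdelta_linear M_bimod).
- exact: semidirect_prod_bilinear.
- exact: bilinear_map_comp (Ml1_bilinear M_bimod) (@linear_fst _ _ _) (idL _).
- exact: bilinear_map_comp (Mr1_bilinear M_bimod) (idL _) (@linear_fst _ _ _).
- by [].
- exact: semidirect_mu_trilinear.
- move=> [a u] xi /=; rewrite (Mdelta_l M_bimod).
  by rewrite (linear0_of (m2 a)) (linear0_of (r2 u)) addr0.
- move=> xi [a u] /=; rewrite (Mdelta_r M_bimod).
  by rewrite (linear0_of (m1 a)) (linear0_of (l1 u)) add0r.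
- move=> xi eta /=.
  (* [delta xi] has no component in [A], so it acts on [M_1] by zero. *)
  rewrite (linear0_of ((Ml1_bilinear M_bimod).1 eta)).
  by rewrite (linear0_of ((Mr1_bilinear M_bimod).2 xi)).
- exact: semidirect_assoc.
- move=> [a u] [b v] xi /=; rewrite (Massoc1_AAM M_bimod).
  by rewrite (linear0_of (n23 a v)) (linear0_of (n13 u b)) !addr0.
- move=> [a u] xi [b v] /=; rewrite (Massoc1_AMA M_bimod).
  by rewrite (linear0_of (n32 a v)) (linear0_of (n12 u b)) add0r addr0.
- move=> xi [a u] [b v] /=; rewrite (Massoc1_MAA M_bimod).
  by rewrite (linear0_of (n31 a v)) (linear0_of (n21 u b)) !add0r.
- exact: semidirect_pentagon.
Qed.
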